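(* Let $n,k,d\ge1$ be integers, let $G>0$, and let $\mathcal{B}=\{\mathbf{w}\in\mathbb{R}^{kd}:\ w_{i,j}\ge0,\ \sum_{i,j}w_{i,j}=1\}$ be the probability simplex, with coordinates indexed by pairs $(i,j)$, $1\le i\le d$, $1\le j\le k$. There exist $\epsilon,\eta>0$ such that for every $\lambda\ge0$ there is a constant $C$ (depending only on $k,d,G,\lambda$) for which the following holds for every integer $T\ge2$. Let $\mathbf{X}_1,\dots,\mathbf{X}_T\in\mathbb{R}^n_{\ge0}$ be any market vectors and $\mathbf{P}_1,\dots,\mathbf{P}_T\in\mathbb{R}^{n\times kd}$ be any matrices whose columns are portfolios, such that $\langle\mathbf{X}_t,\mathbf{P}_t\mathbf{w}\rangle>0$ for all $\mathbf{w}\in\mathcal{B}$ and the losses $g_t(\mathbf{w})=-\log\langle\mathbf{X}_t,\mathbf{P}_t\mathbf{w}\rangle$ satisfy $\|\nabla g_t(\mathbf{w})\|_2\le G$ for all $\mathbf{w}\in\mathcal{B}$ and all $t$. Let $\mathbf{w}_1,\dots,\mathbf{w}_T$ be the allocation vectors played by the procedure EREP (defined in the context) with parameters $\epsilon,\eta,\lambda$. Then for every fixed $\mathbf{w}_*\in\mathcal{B}$, $$\sum_{t=1}^{T}\Bigl(g_t(\mathbf{w}_t)+\lambda L^{\mathcal{G}}_{(\infty,1)}(\mathbf{w}_t)-g_t(\mathbf{w}_* )-\lambda L^{\mathcal{G}}_{(\infty,1)}(\mathbf{w}_* )\Bigr)\le C\log T ,$$ that is, the regret is $O(\log T)$.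
   Context: Setting: there are $n$ stocks partitioned or grouped into $k$ sectors, and $d$ base portfolio selection algorithms $A_1,\dots,A_d$; for each $i\le d$ and $j\le k$ the sub-algorithm $A_{i,j}$ is a copy of $A_i$ operating only on the stocks of sector $j$. A portfolio is a vector in $\mathbb{R}^n$ with nonnegative entries summing to $1$. The column of $\mathbf{P}_t$ indexed by $(i,j)$ is the portfolio proposed by $A_{i,j}$ for round $t$. The market vector $\mathbf{X}_t$ contains the nonnegative relative prices of the $n$ stocks in round $t$. Group norm: for $\mathbf{w}\in\mathbb{R}^{kd}$, $L^{\mathcal{G}}_{(\infty,1)}(\mathbf{w})=\max_{1\le j\le k}\sum_{i=1}^{d}|w_{i,j}|$, the $\ell_\infty/\ell_1$ norm with respect to the grouping of the $kd$ sub-algorithms by sector. Bregman divergence: for a positive-definite matrix $A$, $\mathcal{D}_A(\mathbf{w}\|\mathbf{x})=\frac12(\mathbf{w}-\mathbf{x})^{T}A(\mathbf{w}-\mathbf{x})$. Procedure EREP with parameters $\epsilon,\eta>0$, $\lambda\ge0$: initialize $\mathbf{w}_1=(\frac1{kd},\dots,\frac1{kd})$ and $A_0=\epsilon I_{kd}$ (identity matrix). In each round $t=1,2,\dots$, play $\mathbf{w}_t$, suffer loss $g_t(\mathbf{w}_t)+\lambda L^{\mathcal{G}}_{(\infty,1)}(\mathbf{w}_t)$, and update (gradients are column vectors) $$A_t=A_{t-1}+\nabla g_t(\mathbf{w}_t)\nabla g_t(\mathbf{w}_t)^{T},$$ $$\mathbf{w}_{t+1}=\arg\min_{\mathbf{w}\in\mathcal{B}}\bigl\{\langle\nabla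 g_t(\mathbf{w}_t),\mathbf{w}-\mathbf{w}_t\rangle+\lambda L^{\mathcal{G}}_{(\infty,1)}(\mathbf{w})+\eta\,\mathcal{D}_{A_t}(\mathbf{w}\|\mathbf{w}_t)\bigr\}.$$ *)

(* Defs.v *)
From HB Require Import structures.
From mathcomp Require Import all_boot all_order all_algebra.
From mathcomp Require Import all_classical all_reals all_analysis.

Set Implicit Arguments.
Unset Strict Implicit.
Unset Printing Implicit Defensive.

Import Order.TTheory GRing.Theory Num.Theory.
Import numFieldNormedType.Exports.

Local Open Scope classical_set_scope.
Local Open Scope ring_scope.

(* A vector of R^(kd) is a w : 'cV[R]_(d * k); its coordinate w_(i,j)
   (algorithm i, sector j) is w (mxvec_index i j) 0, where mxvec_index is the
   bijection 'I_d * 'I_k -> 'I_(d * k) of matrix.v. *)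

Definition dot (R : realType) (m : nat) (u v : 'cV[R]_m) : R :=
  \sum_(i < m) u i 0 * v i 0.

(* The library norm `|u| on matrices is the max norm, hence this definition. *)
Definition norm2 (R : realType) (m : nat) (u : 'cV[R]_m) : R :=
  Num.sqrt (dot u u).

Definition simplex (R : realType) (m : nat) : set 'cV[R]_m :=
  [set w | (forall i, 0 <= w i 0) /\ \sum_(i < m) w i 0 = 1].

Definition grad (R : realType) (m : nat) (f : 'cV[R]_m -> R) (w : 'cV[R]_m) :
    'cV[R]_m :=
  \col_(i < m) 'D_(delta_mx i 0) f w.

(* The default value 0 of the maximum is harmless: the sums are nonnegative. *)
Definition group_norm (R : realType) (k d : nat) (w : 'cV[R]_(d * k)) : R :=
  \big[Num.max/0]_(j < k) \sum_(i < d) `|w (mxvec_index i j) 0|.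

Definition bregman (R : realType) (m : nat) (A : 'M[R]_m) (w x : 'cV[R]_m) :
    R :=
  2^-1 * ((w - x)^T *m A *m (w - x)) 0 0.

(* The function is total; ln is the logarithm only where its argument is
   positive, which is required on the simplex in the theorem and then holds in
   a neighbourhood of it, so that grad (log_loss X P) is the actual gradient. *)
Definition log_loss (R : realType) (n m : nat) (X : 'cV[R]_n)
    (P : 'M[R]_(n, m)) (w : 'cV[R]_m) : R :=
  - ln (dot X (P *m w)).

(* Sequences are indexed by nat; rounds are numbered from 1, and the values of
   g and w at 0 are never used. *)
Fixpoint erep_matrix (R : realType) (m : nat) (eps : R)
    (g : nat -> 'cV[R]_m -> R) (w : nat -> 'cV[R]_m) (t : nat) : 'M[R]_m :=
  if t is s.+1 then
    erep_matrix eps g w s + grad (g t) (w t) *m (grad (g t) (w t))^T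
  else eps%:M.

Definition erep_objective (R : realType) (k d : nat) (eps eta lambda : R)
    (g : nat -> 'cV[R]_(d * k) -> R) (w : nat -> 'cV[R]_(d * k)) (t : nat)
    (v : 'cV[R]_(d * k)) : R :=
  dot (grad (g t) (w t)) (v - w t) + lambda * group_norm v
  + eta * bregman (erep_matrix eps g w t) v (w t).

Definition is_argmin (T : Type) (R : realType) (B : set T) (F : T -> R)
    (x : T) : Prop :=
  B x /\ forall y, B y -> F x <= F y.

(* w 1, ..., w T are the allocations played in rounds 1, ..., T.  For
   eps, eta > 0 the objective is strictly convex, so each update has exactly
   one argmin. *)
Definition EREP (R : realType) (k d : nat) (eps eta lambda : R)
    (g : nat -> 'cV[R]_(d * k) -> R) (T : nat) (w : nat -> 'cV[R]_(d * k)) :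
    Prop :=
  w 1%N = const_mx ((k * d)%:R^-1) /\
  forall t, (1 <= t < T)%N ->
    is_argmin (@simplex R (d * k)) (erep_objective eps eta lambda g w t)
      (w t.+1).

(* Main.v *)
(* Write z_t = <grad g_t(w_t), w_t - u>. Since g_t(w_t) - g_t(u) = ln r with
   r = <X_t, P_t u> / <X_t, P_t w_t> and z_t = r - 1 <= 2 G, exp-concavity gives
   g_t(w_t) - g_t(u) <= z_t - (eta / 2) z_t^2 with eta = 1 / (2 (1 + G)).
   Strong convexity of the update bounds z_t plus the penalty at w_(t+1) by a
   difference of Bregman divergences for A_t, up to
   (grad g_t(w_t))^T A_t^-1 grad g_t(w_t) / (2 eta). Passing from A_t to A_(t-1)
   absorbs the quadratic term, and the last expression is at most
   ln (det A_t / det A_(t-1)) / (2 eta) by the rank-one determinant formula, so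
   everything telescopes. With eps = 1, the Leibniz formula gives the crude bound
   det A_t <= m! (1 + t G^2)^m for m = d k, which suffices. The final round has
   no update and contributes at most 2 G to the loss difference. *)
Require Import Defs.
From HB Require Import structures.
From mathcomp Require Import all_boot all_order all_algebra perm.
From mathcomp Require Import all_classical all_reals all_analysis.
From mathcomp Require Import ring lra.
Set Implicit Arguments.
Unset Strict Implicit.
Unset Printing Implicit Defensive.

Import Order.TTheory GRing.Theory Num.Theory.
Import numFieldNormedType.Exports.
Local Open Scope classical_set_scope.
Local Open Scope ring_scope.

(** The block matrix [M] factors both as lower times upper and as upper times lower triangular;
    comparing the two determinants gives the formula. *)
Lemma det_one_sub_rank1 (R : comPzRingType) (m : nat) (u : 'cV[R]_m)
    (v : 'rV[R]_m) : \det (1%:M - u *m v) = 1 - (v *m u) 0 0.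
Proof.
pose M : 'M[R]_(m + 1) := block_mx 1%:M u v 1%:M.
have ML : M = block_mx 1%:M 0 v 1%:M *m block_mx 1%:M u 0 (1%:M - v *m u).
  by rewrite mulmx_block !mul1mx !mulmx1 !mul0mx !addr0 [v *m u + _]addrC subrK.
have MU : M = block_mx (1%:M - u *m v) u 0 1%:M *m block_mx 1%:M 0 v 1%:M.
  by rewrite mulmx_block !mul1mx !mulmx1 !mulmx0 !add0r subrK.
have := congr1 determinant MU.
rewrite {1}ML !det_mulmx !det_lblock !det_ublock !det1 !mulr1 !mul1r => <-.
by rewrite det_mx11 !mxE.
Qed.

(** * Inner products, Bregman divergences and the simplex *)

Section Dot.
Variables (R : realType) (m : nat).
Implicit Types (u v x y : 'cV[R]_m) (A : 'M[R]_m) (a s : R).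

Lemma dotE u v : dot u v = (u^T *m v) 0 0.
Proof. by rewrite mxE; apply: eq_bigr => i _; rewrite mxE. Qed.

Lemma dotC u v : dot u v = dot v u.
Proof. by apply: eq_bigr => i _; rewrite mulrC. Qed.

Lemma dotDr u v x : dot u (v + x) = dot u v + dot u x.
Proof. by rewrite !dotE mulmxDr mxE. Qed.

Lemma dotZr a u v : dot u (a *: v) = a * dot u v.
Proof. by rewrite !dotE -scalemxAr mxE. Qed.

Lemma dotDl u v x : dot (u + v) x = dot u x + dot v x.
Proof. by rewrite dotC dotDr !(dotC x). Qed.

Lemma dotZl a u v : dot (a *: u) v = a * dot u v.
Proof. by rewrite dotC dotZr dotC. Qed.

Lemma dotBr u v x : dot u (v - x) = dot u v - dot u x.
Proof. by rewrite -scaleN1r dotDr dotZr mulN1r. Qed.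

Lemma dotNr u v : dot u (- v) = - dot u v.
Proof. by rewrite -scaleN1r dotZr mulN1r. Qed.

Lemma dot_ge0 u : 0 <= dot u u.
Proof. by apply: sumr_ge0 => i _; rewrite -expr2 sqr_ge0. Qed.

Lemma dot_eq0 u : dot u u = 0 -> u = 0.
Proof.
move=> /eqP; rewrite psumr_eq0 => [/allP u0|i _]; last by rewrite -expr2 sqr_ge0.
apply/colP => i; rewrite mxE; apply/eqP.
by have := u0 i (mem_index_enum _); rewrite /= mulf_eq0 orbb.
Qed.

Lemma dot_mulmx A u v : dot u (A *m v) = dot (A^T *m u) v.
Proof. by rewrite !dotE trmx_mul trmxK mulmxA. Qed.

Lemma mul_outer u v x : u *m v^T *m x = dot v x *: u.
Proof.
rewrite -mulmxA [v^T *m x]mx11_scalar -dotE.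
by rewrite mul_mx_scalar.
Qed.

Lemma bregmanE A u v : bregman A u v = 2^-1 * dot (u - v) (A *m (u - v)).
Proof. by rewrite /bregman dotE mulmxA. Qed.

(** Used to exchange [A_t] for [A_(t-1)]: the square that appears is the one supplied by
    exp-concavity. *)
Lemma bregman_add_outer A v u x :
  bregman (A + v *m v^T) u x = bregman A u x + 2^-1 * dot v (u - x) ^+ 2.
Proof.
rewrite !bregmanE; set z := u - x.
rewrite mulmxDl dotDr mul_outer dotZr (dotC z v).
by rewrite mulrDr expr2.
Qed.

Lemma normr_coord_le_norm2 u i : `|u i 0| <= norm2 u.
Proof.
rewrite /norm2 -sqrtr_sqr ler_wsqrtr// /dot (bigD1 i)//= -expr2 lerDl.
by apply: sumr_ge0 => j _; rewrite -expr2 sqr_ge0.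
Qed.

(** Pairing [u] with a simplex point averages the coordinates of [u], so each of the two pairings is
    at most [G] in absolute value. *)
Lemma dot_simplex_sub_le u v x (G : R) : (forall i, `|u i 0| <= G) ->
  @simplex R m v -> @simplex R m x -> `|dot u (v - x)| <= 2 * G.
Proof.
move=> uG [v0 v1] [x0 x1].
have dle (z : 'cV[R]_m) : simplex z -> `|dot u z| <= G.
  move=> [z0 z1]; apply: (le_trans (ler_norm_sum _ _ _)).
  rewrite -[leRHS]mulr1 -z1 mulr_sumr; apply: ler_sum => i _.
  by rewrite normrM (ger0_norm (z0 i)) ler_wpM2r.
rewrite dotBr (le_trans (ler_normB _ _))//.
by rewrite mulr_natl mulr2n lerD// dle.
Qed.

(** The coordinates of [u - v] lie in [-1, 1], so the preceding lemma applies with [G = 1]. *)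
Lemma dot_simplex_sub_self_le u v : @simplex R m u -> @simplex R m v ->
  dot (u - v) (u - v) <= 2.
Proof.
move=> su sv; rewrite (le_trans (ler_norm _))// -[leRHS]mulr1.
apply: dot_simplex_sub_le => // i.
have le1 (z : 'cV[R]_m) : simplex z -> 0 <= z i 0 <= 1.
  move=> [z0 z1]; rewrite z0 -z1 (bigD1 i)//= lerDl.
  by apply: sumr_ge0 => j _; exact: z0.
rewrite !mxE; have := le1 _ su; have := le1 _ sv.
by move=> /andP[? ?] /andP[? ?]; rewrite ler_norml; apply/andP; split; lra.
Qed.

Lemma simplex_conv s u v : 0 <= s <= 1 -> @simplex R m u -> @simplex R m v ->
  @simplex R m (u + s *: (v - u)).
Proof.
move=> /andP[s0 s1] [u0 u1] [v0 v1]; split=> [i|].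
  rewrite !mxE; have := u0 i; have := v0 i; nra.
under eq_bigr do rewrite !mxE.
by rewrite big_split/= -mulr_sumr big_split/= sumrN u1 v1 subrr mulr0 addr0.
Qed.

End Dot.

(** * Positive definite matrices and determinants under rank-one updates *)

Section PositiveDefinite.
Variables (R : realType) (m : nat).
Implicit Types (A : 'M[R]_m) (u v x y : 'cV[R]_m).

(** Symmetry is required separately: over the reals, positivity of the quadratic form does not imply
    it. *)
Definition posdef A := A^T = A /\ forall x, x != 0 -> 0 < dot x (A *m x).

Lemma posdef_ge0 A x : posdef A -> 0 <= dot x (A *m x).
Proof.
move=> [_ Apos]; have [->|/Apos/ltW//] := eqVneq x 0.
by rewrite mulmx0 dotE mulmx0 mxE.
Qed.

Lemma posdef_unitmx A : posdef A -> A \in unitmx.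
Proof.
move=> [Asym Apos]; rewrite -row_free_unit -kermx_eq0; apply/rowV0P => v.
move=> /sub_kermxP vA0; apply/eqP/contraT => vn0.
have /Apos : v^T != 0 by rewrite -trmx0 (inj_eq (@trmx_inj _ _ _)).
by rewrite dotE trmxK mulmxA vA0 mul0mx mxE ltxx.
Qed.

Lemma posdef_scalar (a : R) : 0 < a -> posdef a%:M.
Proof.
move=> a0; split=> [|x x0]; first exact: tr_scalar_mx.
rewrite mul_scalar_mx dotZr mulr_gt0// lt_def dot_ge0 andbT.
by apply: contra x0 => /eqP/dot_eq0->.
Qed.

Lemma posdef_add_outer A v : posdef A -> posdef (A + v *m v^T).
Proof.
move=> [Asym Apos]; split=> [|x x0].
  by rewrite linearD/= trmx_mul trmxK Asym.
rewrite mulmxDl mul_outer dotDr dotZr (dotC x v) ltr_wpDr ?Apos//.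
by rewrite -expr2 sqr_ge0.
Qed.

(** Expand the nonnegative quadratic form of [A] at [eta *: x + invmx A *m v] and divide by
    [2 * eta]. *)
Lemma posdef_young A v x (eta : R) : posdef A -> 0 < eta ->
  - dot v x - eta * (2^-1 * dot x (A *m x))
    <= (2 * eta)^-1 * dot v (invmx A *m v).
Proof.
move=> pA eta0; set y := invmx A *m v; have Ay : A *m y = v.
  by rewrite mulmxA mulmxV ?mul1mx// posdef_unitmx.
have := @posdef_ge0 A (eta *: x + y) pA.
rewrite mulmxDr -scalemxAr Ay !dotDr !dotDl !dotZr !dotZl.
rewrite (dot_mulmx A y) pA.1 Ay (dotC x v) (dotC y v) => H.
rewrite -(ler_pM2l (_ : 0 < 2 * eta)); last by rewrite mulr_gt0.
rewrite mulVKf ?lt0r_neq0 ?mulr_gt0//.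
have -> : 2 * eta * (- dot v x - eta * (2^-1 * dot x (A *m x))) =
  - (2 * eta * dot v x) - eta * (eta * dot x (A *m x)) by field.
lra.
Qed.

Lemma det_sub_outer A v : A \in unitmx ->
  \det (A - v *m v^T) = \det A * (1 - dot v (invmx A *m v)).
Proof.
move=> uA; have -> : A - v *m v^T = A *m (1%:M - invmx A *m v *m v^T).
  by rewrite mulmxBr mulmx1 !mulmxA mulmxV// mul1mx.
by rewrite det_mulmx det_one_sub_rank1 -dotE.
Qed.

(** The update multiplies the determinant by 1 + v^T A^-1 v, which is at least 1. Positivity thus
    passes along rank-one updates without any spectral argument. *)
Lemma posdef_det_add_outer_gt0 A v : posdef A -> 0 < \det A ->
  0 < \det (A + v *m v^T).
Proof.
move=> pA dA; have uA := posdef_unitmx pA.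
have -> : A + v *m v^T = A *m (1%:M - invmx A *m (- v) *m v^T).
  by rewrite mulmxBr mulmx1 !mulmxA mulmxV// mul1mx mulNmx opprK.
rewrite det_mulmx det_one_sub_rank1 mulmxN mulmxN mxE opprK mulr_gt0//.
rewrite -dotE ltr_wpDr//.
set y := invmx A *m v; have -> : v = A *m y by rewrite mulmxA mulmxV// mul1mx.
by rewrite dotC posdef_ge0.
Qed.

(** With A' the updated matrix and q = v^T A'^-1 v, downdating gives det A = det A' (1 - q). Both
    determinants are positive, so q < 1, and ln (1 - q) <= - q concludes. *)
Lemma dot_invmx_le_ln_det A v : posdef A -> 0 < \det A ->
  dot v (invmx (A + v *m v^T) *m v) <=
    ln (\det (A + v *m v^T)) - ln (\det A).
Proof.
move=> pA dA; set A' := A + v *m v^T.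
have dA' : 0 < \det A' by exact: posdef_det_add_outer_gt0.
have uA' : A' \in unitmx by apply/posdef_unitmx/posdef_add_outer.
have dE := det_sub_outer v uA'; rewrite addrK in dE.
have q_lt1 : -1 < - dot v (invmx A' *m v).
  by rewrite ltrN2 -subr_gt0 -(pmulr_rgt0 _ dA') -dE.
have := le_ln1Dx q_lt1.
rewrite dE lnM ?posrE//; last by rewrite -(pmulr_rgt0 _ dA') -dE.
lra.
Qed.

Lemma det_le_entries A (M : R) : (forall i j, `|A i j| <= M) ->
  \det A <= (m`!)%:R * M ^+ m.
Proof.
move=> AM; rewrite (le_trans (ler_norm _))// (le_trans (ler_norm_sum _ _ _))//.
have <- : #|'S_m| = m`!.
  by rewrite card_Sn.
rewrite mulr_natl -sumr_const; apply: ler_sum => s _.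
rewrite normrM normrX normrN1 expr1n mul1r normr_prod.
rewrite -[X in M ^+ X]card_ord -prodr_const.
by apply: ler_prod => i _; rewrite normr_ge0 AM.
Qed.

End PositiveDefinite.

(** * Exp-concavity of the logarithmic loss *)

(** Put s = sqrt r and c = 1 / (4 (1 + G)). Since ln r = 2 ln s <= 2 (s - 1), the slack is at least
    (s - 1)^2 (1 - c (s + 1)^2). *)
Lemma ln_le_sub_sqr (R : realType) (G r : R) : 0 < r -> r - 1 <= 2 * G ->
  ln r <= (r - 1) - (4 * (1 + G))^-1 * (r - 1) ^+ 2.
Proof.
move=> r0 rG; pose s := Num.sqrt r.
have s0 : 0 < s by rewrite sqrtr_gt0.
have rE : r = s ^+ 2 by rewrite sqr_sqrtr// ltW.
have lns : ln s <= s - 1.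
  by have := @le_ln1Dx _ (s - 1); rewrite [1 + _]addrC subrK; apply; lra.
(* The hypotheses on [r] already force 2 G > -1. *)
have G4 : 0 < 4 * (1 + G) by lra.
(* Here (s + 1)^2 <= 2 (s^2 + 1) = 2 (r + 1) <= 4 (1 + G). *)
have sG : (4 * (1 + G))^-1 * (s + 1) ^+ 2 <= 1.
  by rewrite mulrC ler_pdivrMr// mul1r; move: rG; rewrite rE; have := sqr_ge0 (s - 1); nra.
have -> : ln r = 2 * ln s by rewrite rE lnXn// mulr_natl.
rewrite rE; set c := (_)^-1 in sG *.
have H : 0 <= (s - 1) ^+ 2 * (1 - c * (s + 1) ^+ 2).
  by rewrite mulr_ge0 ?sqr_ge0// subr_ge0.
have : (s - 1) ^+ 2 * (1 - c * (s + 1) ^+ 2) =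
  s ^+ 2 - 1 - c * (s ^+ 2 - 1) ^+ 2 - 2 * (s - 1) by ring.
lra.
Qed.

Section LogLoss.
Variables (R : realType) (n m : nat) (X : 'cV[R]_n) (P : 'M[R]_(n, m)).
Implicit Types u w : 'cV[R]_m.

Lemma grad_log_loss w : 0 < dot X (P *m w) ->
  grad (log_loss X P) w = - (dot X (P *m w))^-1 *: (P^T *m X).
Proof.
move=> p0; apply/colP => i; rewrite !mxE.
set p := dot X (P *m w) in p0 *; pose e : 'cV[R]_m := delta_mx i 0.
pose q := dot X (P *m e).
have -> : \sum_j P^T i j * X j 0 = q.
  apply: eq_bigr => j _; rewrite mulrC !mxE; congr (_ * _).
  rewrite (bigD1 i)//= big1 ?addr0 => [|l li]; first by rewrite !mxE !eqxx mulr1.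
  by rewrite !mxE (negbTE li) mulr0.
(* The difference quotients along [e] coincide with those of a function of one real variable, to
   which the chain rule applies. *)
have -> : 'D_e (log_loss X P) w = 'D_1 (fun h : R => - ln (h * q + p)) 0.
  pose phi (h : R) : R := - ln (h * q + p).
  have E : (fun h : R => h^-1 * (log_loss X P (h *: e + w) - log_loss X P w)) =
      (fun h => h^-1 * (phi (h * 1 + 0) - phi 0)).
    apply/funext => h; rewrite /phi /log_loss addr0 mulr1 mul0r add0r.
    by rewrite mulmxDr -scalemxAr dotDr dotZr.
  exact: (congr1 (fun F : R -> R => lim (F @ (0 : R)^')) E).
have dl : is_derive (0 * q + p) 1 (@ln R) p^-1.
  by rewrite mul0r add0r; exact: is_derive1_ln.
have da : is_derive (0 : R) 1 (fun h : R => h * q + p) q.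
  by apply: is_derive_eq; rewrite addr0 ?scaler0 ?add0r [_ *: _]mulr1.
have dc := @is_derive1_comp _ (@ln R) (fun h => h * q + p) _ _ _ dl da.
have dn := is_deriveN dc.
by rewrite (@derive_val _ _ _ _ _ _ _ dn) mulNr.
Qed.

Lemma dot_grad_log_loss u w : 0 < dot X (P *m w) ->
  dot (grad (log_loss X P) w) (w - u)
    = dot X (P *m u) / dot X (P *m w) - 1.
Proof.
move=> p0; rewrite grad_log_loss// dotZl.
have -> : dot (P^T *m X) (w - u) = dot X (P *m w) - dot X (P *m u).
  by rewrite -dotBr -mulmxBr !dotE trmx_mul trmxK mulmxA.
by field; rewrite gt_eqF.
Qed.

Lemma log_loss_sub_le_grad (G : R) u w : 0 < dot X (P *m w) ->
    0 < dot X (P *m u) ->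
    `|dot (grad (log_loss X P) w) (w - u)| <= 2 * G ->
  log_loss X P w - log_loss X P u <= dot (grad (log_loss X P) w) (w - u)
    - (4 * (1 + G))^-1 * dot (grad (log_loss X P) w) (w - u) ^+ 2.
Proof.
move=> w0 u0; rewrite dot_grad_log_loss// => dG.
set r := _ / _ in dG *.
have r0 : 0 < r by rewrite divr_gt0.
have -> : log_loss X P w - log_loss X P u = ln r.
  by rewrite /log_loss /r ln_div ?posrE// opprK addrC.
by apply: ln_le_sub_sqr => //; exact: le_trans (ler_norm _) dG.
Qed.

End LogLoss.

(** * Convexity of the penalty and optimality of the update *)

Section GroupNorm.
Variables (R : realType) (k d : nat).
Implicit Types (u w : 'cV[R]_(d * k)) (s : R).

Lemma group_norm_ge0 w : 0 <= @group_norm R k d w.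
Proof. exact: bigmax_ge_id. Qed.

Lemma group_norm_conv s u w : 0 <= s <= 1 ->
  @group_norm R k d (w + s *: (u - w))
    <= (1 - s) * @group_norm R k d w + s * @group_norm R k d u.
Proof.
move=> /andP[s0 s1]; have s1' : 0 <= 1 - s by rewrite subr_ge0.
apply: bigmax_le => [|j _]; first by rewrite addr_ge0// mulr_ge0// group_norm_ge0.
have le_gn (v : 'cV[R]_(d * k)) : \sum_(i < d) `|v (mxvec_index i j) 0| <= @group_norm R k d v.
  exact: (le_bigmax _ (fun j => \sum_(i < d) `|v (mxvec_index i j) 0|)).
apply: (@le_trans _ _ ((1 - s) * \sum_(i < d) `|w (mxvec_index i j) 0|
  + s * \sum_(i < d) `|u (mxvec_index i j) 0|)); last first.
  by rewrite lerD// ler_wpM2l.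
rewrite !mulr_sumr -big_split/=; apply: ler_sum => i _; rewrite !mxE.
set a := w _ _; set b := u _ _.
have -> : a + s * (b - a) = (1 - s) * a + s * b by ring.
by rewrite (le_trans (ler_normD _ _))// !normrM (ger0_norm s0) (ger0_norm s1').
Qed.

End GroupNorm.

(** An exact identity for a quadratic along a segment; the subtracted term is the strong convexity
    gain. Symmetry of [A] merges the two cross terms. *)
Lemma bregman_conv (R : realType) (m : nat) (A : 'M[R]_m) (u x w : 'cV[R]_m)
    (s : R) : A^T = A ->
  bregman A (x + s *: (u - x)) w
    = (1 - s) * bregman A x w + s * bregman A u w - s * (1 - s) * bregman A u x.
Proof.
move=> Asym; rewrite !bregmanE.
set p := x - w; set q := u - x.
have -> : x + s *: q - w = p + s *: q by rewrite /p addrAC.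
have -> : u - w = p + q by rewrite /p /q [RHS]addrC addrA subrK.
move: p q => p q; rewrite !mulmxDr -scalemxAr !dotDr !dotDl !dotZr !dotZl.
have -> : dot q (A *m p) = dot p (A *m q) by rewrite dot_mulmx Asym dotC.
by ring.
Qed.

Lemma le0_of_le_mul_small (R : realType) (c K : R) :
  (forall s, 0 < s <= 1 -> c <= s * K) -> c <= 0.
Proof.
move=> H; rewrite leNgt; apply/negP => c0.
have K0 : c <= K by rewrite -[K]mul1r H// ltr01 lexx.
(* Taking [s = 1] gave [c <= K], so this [s] is admissible; it yields c (c + K) <= c K, impossible
   for [c > 0]. *)
have := H (c / (c + K)); rewrite divr_gt0 ?ler_pdivrMr ?mul1r; [|lra..].
have -> : c <= c + K by lra.
move=> /(_ isT); rewrite mulrAC ler_pdivlMr; last lra.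
nra.
Qed.

(* Comparing the minimizer x with x + s (u - x) and letting s tend to 0 gains
   the strong convexity term on the left. *)
Lemma argmin_bregman_le (R : realType) (k d : nat) (A : 'M[R]_(d * k))
    (eta lambda : R) (v w x u : 'cV[R]_(d * k)) :
    posdef A -> 0 < eta -> 0 <= lambda ->
    is_argmin (@simplex R (d * k)) (fun y => dot v (y - w)
      + lambda * @group_norm R k d y + eta * bregman A y w) x ->
    @simplex R (d * k) u ->
  dot v (x - w) + lambda * @group_norm R k d x + eta * bregman A x w
    + eta * bregman A u x
  <= dot v (u - w) + lambda * @group_norm R k d u + eta * bregman A u w.
Proof.
move=> pA eta0 lambda0 [sx xmin] su; rewrite -subr_le0.
(* After division by [s], minimality leaves the gain with factor [1 - s]; the missing fraction [s]
   of it is the error term. *)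
apply: (@le0_of_le_mul_small _ _ (eta * bregman A u x)) => s /andP[s0 s1].
have s01 : 0 <= s <= 1 by rewrite (ltW s0).
have := xmin _ (simplex_conv s01 sx su).
rewrite (bregman_conv _ _ _ _ pA.1).
have gnc := ler_wpM2l lambda0 (@group_norm_conv _ k d s u x s01).
have -> : dot v (x + s *: (u - x) - w)
    = (1 - s) * dot v (x - w) + s * dot v (u - w).
  by rewrite !dotBr dotDr dotZr dotBr; ring.
move=> H; rewrite -(ler_pM2l s0).
nra.
Qed.

(** * Positivity and growth of the matrices A_t *)

Section ErepMatrix.
Variables (R : realType) (m : nat) (eps : R).
Variables (g : nat -> 'cV[R]_m -> R) (w : nat -> 'cV[R]_m).
Hypothesis eps0 : 0 < eps.

Lemma erep_matrix_posdef s : posdef (erep_matrix eps g w s).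
Proof.
by elim: s => [|s IHs]/=; [exact: posdef_scalar|exact: posdef_add_outer].
Qed.

Lemma erep_matrix_det_gt0 s : 0 < \det (erep_matrix eps g w s).
Proof.
elim: s => [|s IHs]/=; first by rewrite det_scalar exprn_gt0.
by apply: posdef_det_add_outer_gt0 => //; exact: erep_matrix_posdef.
Qed.

Lemma erep_matrix_entry_le (G : R) s i j :
    (forall t, (1 <= t <= s)%N -> forall l, `|grad (g t) (w t) l 0| <= G) ->
  `|erep_matrix eps g w s i j| <= eps + s%:R * G ^+ 2.
Proof.
elim: s => [_|s IHs gG] /=.
  rewrite mul0r addr0 mxE; case: (i == j); first by rewrite mulr1n gtr0_norm.
  by rewrite mulr0n normr0 ltW.
rewrite mxE (le_trans (ler_normD _ _))// -natr1 mulrDl addrA mul1r lerD//.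
  by apply: IHs => t /andP[t1 ts]; apply: gG; rewrite t1 leqW.
rewrite mxE big_ord1 [_^T _ _]mxE normrM expr2.
by apply: ler_pM => //; apply: gG; rewrite /= leqnn.
Qed.

End ErepMatrix.

(** * One-round inequality and telescoping *)

Section Regret.
Variables (R : realType) (k d : nat) (eps eta lambda : R).
Variables (g : nat -> 'cV[R]_(d * k) -> R) (T : nat).
Variables (w : nat -> 'cV[R]_(d * k)) (u : 'cV[R]_(d * k)).
Hypotheses (eps0 : 0 < eps) (eta0 : 0 < eta) (lambda0 : 0 <= lambda).
Hypothesis w_erep : @EREP R k d eps eta lambda g T w.
Hypothesis su : @simplex R (d * k) u.
Local Notation A := (erep_matrix eps g w).
Local Notation L := (@group_norm R k d).
Local Notation nabla t := (grad (g t) (w t)).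

Lemma EREP_simplex t : (1 <= k)%N -> (1 <= d)%N -> (1 <= t <= T)%N ->
  @simplex R (d * k) (w t).
Proof.
move=> k1 d1 /andP[]; case: t => [//|[_ _|t _ tT]].
  have [-> _] := w_erep; split=> [i|]; first by rewrite mxE invr_ge0.
  under eq_bigr do rewrite mxE.
  rewrite sumr_const card_ord mulnC -[LHS]mulr_natl mulfV// pnatr_eq0.
  by rewrite -lt0n muln_gt0 d1.
by have [_ /(_ t.+1)[]] := w_erep.
Qed.

(* The penalty is paid at w t.+1 in the update, so it telescopes against the
   penalty paid in round t. *)
Lemma erep_step t : (1 <= t < T)%N ->
  dot (nabla t) (w t - u) - eta / 2 * dot (nabla t) (w t - u) ^+ 2
    + lambda * L (w t.+1) - lambda * L u
  <= eta * bregman (A t.-1) u (w t) - eta * bregman (A t) u (w t.+1)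
    + (2 * eta)^-1 * (ln (\det (A t)) - ln (\det (A t.-1))).
Proof.
case: t => // s tT; have [_ /(_ _ tT) wmin] := w_erep.
have pA := erep_matrix_posdef g w eps0 s.+1.
have := argmin_bregman_le pA eta0 lambda0 wmin su.
(* The displacement from [w_t] to [w_(t+1)] is paid for by the Bregman term between these two
   points. *)
have := posdef_young (nabla s.+1) (w s.+2 - w s.+1) pA eta0.
have := dot_invmx_le_ln_det (nabla s.+1) (erep_matrix_posdef g w eps0 s)
  (erep_matrix_det_gt0 g w eps0 s).
have eta2 : 0 < (2 * eta)^-1 by rewrite invr_gt0 mulr_gt0.
move=> /(ler_wpM2l (ltW eta2)).
rewrite -bregmanE -/(A s.+1) [bregman (A s.+1) u (w s.+1)]bregman_add_outer.
rewrite -!/(A s.+1) -(opprB u) dotNr /=.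
by move=> H1 H2 H3; lra.
Qed.

Hypothesis g_concave : forall t, (1 <= t < T)%N ->
  g t (w t) - g t u <= dot (nabla t) (w t - u)
    - eta / 2 * dot (nabla t) (w t - u) ^+ 2.

(** The penalty at [w s.+1] is kept on the left because it is the penalty of the next round; the
    induction step trades it for the one at [w s.+2]. *)
Lemma erep_regret_le s : (s < T)%N ->
  \sum_(1 <= t < s.+1) (g t (w t) + lambda * L (w t) - g t u - lambda * L u)
    + lambda * L (w s.+1)
  <= lambda * L (w 1%N) + eta * bregman (A 0) u (w 1%N)
     - eta * bregman (A s) u (w s.+1)
     + (2 * eta)^-1 * (ln (\det (A s)) - ln (\det (A 0))).
Proof.
elim: s => [_|s IHs sT]; first by rewrite big_geq// add0r !subrr mulr0 addr0 addrK.
rewrite big_nat_recr//=.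
have := IHs (ltnW sT); have := @erep_step s.+1 sT; have := @g_concave s.+1 sT.
move=> /= H1 H2 H3; lra.
Qed.

End Regret.

(** * Logarithmic growth of the determinant and choice of constants *)

Lemma ln_det_le (R : realType) (m : nat) (A : 'M[R]_m) (M : R) :
  0 < M -> 0 < \det A -> (forall i j, `|A i j| <= M) ->
  ln (\det A) <= ln (m`!)%:R + m%:R * ln M.
Proof.
move=> M0 dA /det_le_entries le_det.
have fact0 : 0 < (m`!)%:R :> R by rewrite ltr0n fact_gt0.
rewrite mulr_natl -lnXn// -lnM ?posrE ?exprn_gt0//.
by rewrite ler_ln ?posrE// mulr_gt0// exprn_gt0.
Qed.

Theorem corollary1 (R : realType) :
  exists C : nat -> nat -> R -> R -> R,
  forall (n k d : nat) (G : R),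
  (1 <= n)%N -> (1 <= k)%N -> (1 <= d)%N -> 0 < G ->
  exists eps eta : R, 0 < eps /\ 0 < eta /\
  forall lambda : R, 0 <= lambda ->
  forall T : nat, (2 <= T)%N ->
  forall (X : nat -> 'cV[R]_n) (P : nat -> 'M[R]_(n, d * k))
         (w : nat -> 'cV[R]_(d * k)),
  let B := @simplex R (d * k) in
  let g := fun t => log_loss (X t) (P t) in
  (forall t, (1 <= t <= T)%N -> forall s, 0 <= X t s 0) ->
  (forall t, (1 <= t <= T)%N -> forall c, @simplex R n (col c (P t))) ->
  (forall t, (1 <= t <= T)%N -> forall v, B v -> 0 < dot (X t) (P t *m v)) ->
  (forall t, (1 <= t <= T)%N -> forall v, B v -> norm2 (grad (g t) v) <= G) ->
  @EREP R k d eps eta lambda g T w ->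
  forall wstar : 'cV[R]_(d * k), B wstar ->
  \sum_(1 <= t < T.+1)
     (g t (w t) + lambda * @group_norm R k d (w t)
      - g t wstar - lambda * @group_norm R k d wstar)
    <= C k d G lambda * ln (T%:R).
Proof.
(* [C0] collects what is free of [T]: the initial penalty, 1 for the starting divergence, 2 G for
   the last round, and 1 / (2 eta) = 1 + G times the constant part of the log-determinant bound. *)
pose C0 k d (G lambda : R) := lambda * @group_norm R k d (const_mx ((k * d)%:R^-1))
  + 1 + 2 * G + (1 + G) * (ln ((d * k)`!)%:R + (d * k)%:R * ln (1 + G ^+ 2)).
(* As [T >= 2], dividing by [ln 2] lets [ln T] absorb [C0]; the other summand is the [ln T] part of
   the log-determinant bound. *)
exists (fun k d G lambda => C0 k d G lambda / ln 2 + (1 + G) * (d * k)%:R).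
(* This [eta] makes [eta / 2] the constant of [ln_le_sub_sqr]. *)
move=> n k d G _ k1 d1 G0; exists 1, (2 * (1 + G))^-1.
have G1 : 0 < 1 + G by rewrite addr_gt0.
have eta0 : 0 < (2 * (1 + G))^-1 by rewrite invr_gt0 mulr_gt0.
split=> //; split=> // lambda lambda0 T T2 X P w B g _ _ dot_gt0 grad_le w_erep u su.
have sw t : (1 <= t <= T)%N -> B (w t) by exact: EREP_simplex w_erep _ k1 d1.
have coord_le t : (1 <= t <= T)%N -> forall i, `|grad (g t) (w t) i 0| <= G.
  move=> tT i; apply: le_trans (grad_le t tT _ (sw t tT)).
  exact: normr_coord_le_norm2.
have dot_le t : (1 <= t <= T)%N -> `|dot (grad (g t) (w t)) (w t - u)| <= 2 * G.
  by move=> tT; apply: dot_simplex_sub_le => //; [exact: coord_le|exact: sw].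
have g_concave t : (1 <= t <= T)%N -> g t (w t) - g t u <=
    dot (grad (g t) (w t)) (w t - u)
    - (2 * (1 + G))^-1 / 2 * dot (grad (g t) (w t)) (w t - u) ^+ 2.
  move=> tT; rewrite -invfM mulrAC -natrM.
  by apply: log_loss_sub_le_grad; [apply/dot_gt0/sw|apply: dot_gt0|apply: dot_le].
case: T T2 => // s s1 in dot_gt0 grad_le w_erep sw coord_le dot_le g_concave *.
have last_le : g s.+1 (w s.+1) - g s.+1 u <= 2 * G.
  have sT : (1 <= s.+1 <= s.+1)%N by rewrite leqnn.
  have := g_concave _ sT; have := ler_normlW (dot_le _ sT).
  have := mulr_ge0 (ltW eta0) (sqr_ge0 (dot (grad (g s.+1) (w s.+1)) (w s.+1 - u))).
  lra.
have g_concave' t : (1 <= t < s.+1)%N -> g t (w t) - g t u <=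
    dot (grad (g t) (w t)) (w t - u)
    - (2 * (1 + G))^-1 / 2 * dot (grad (g t) (w t)) (w t - u) ^+ 2.
  by move=> /andP[t1 /ltnW tT]; apply: g_concave; rewrite t1.
(* The penalty of the last round is the one left over in [erep_regret_le], so splitting off that
   round costs only [last_le]. *)
rewrite big_nat_recr//=.
have := erep_regret_le ltr01 eta0 lambda0 w_erep su g_concave' (ltnSn s).
set S := \sum_(1 <= t < s.+1) _; set A := erep_matrix 1 g w s.
have L2 : 0 < ln 2 :> R by rewrite ln_gt0// ltr1n.
have L2T : ln 2 <= ln s.+1%:R :> R by rewrite ler_ln ?posrE ?ltr0n// ler_nat.
have breg0 : 0 <= bregman A u (w s.+1).
  by rewrite bregmanE mulr_ge0// posdef_ge0//; exact: erep_matrix_posdef.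
(* The squared distance is at most 2 and [eta < 1]. *)
have breg1 : (2 * (1 + G))^-1 * bregman (1%:M) u (w 1%N) <= 1.
  rewrite bregmanE mul1mx mulrA -[leRHS]mulr1.
  have := dot_simplex_sub_self_le su (sw 1%N isT); have := dot_ge0 (u - w 1%N).
  rewrite -invfM ler_pdivrMl; nra.
have detA : ln (\det A) <= ln ((d * k)`!)%:R
    + (d * k)%:R * (ln s.+1%:R + ln (1 + G ^+ 2)).
  have G2 : 0 < 1 + G ^+ 2 by rewrite ltr_pwDl// sqr_ge0.
  rewrite -lnM ?posrE ?ltr0n//; apply: ln_det_le.
  - by rewrite mulr_gt0// ltr0n.
  - exact: erep_matrix_det_gt0.
  (* The entry bound 1 + s G^2 is enlarged to a product so that its logarithm splits into [ln T] and
     a constant. *)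
  move=> i j; have -> : s.+1%:R * (1 + G ^+ 2) = 1 + s%:R * G ^+ 2 + (s%:R + G ^+ 2).
    by rewrite -natr1; ring.
  rewrite ler_wpDr ?addr_ge0 ?sqr_ge0//; apply: erep_matrix_entry_le => //.
  by move=> t /andP[t1 ts]; apply: coord_le; rewrite t1 leqW.
have -> : (2 * (2 * (1 + G))^-1)^-1 = 1 + G by field; rewrite gt_eqF.
rewrite det1 ln1 subr0.
have w1 : w 1%N = const_mx ((k * d)%:R^-1) := w_erep.1.
have Lu : 0 <= lambda * @group_norm R k d u by rewrite mulr_ge0 ?group_norm_ge0.
have CT : C0 k d G lambda <= C0 k d G lambda / ln 2 * ln s.+1%:R.
  rewrite mulrAC ler_pdivlMr// ler_wpM2l// /C0.
  have lnG : 0 <= ln (1 + G ^+ 2) by rewrite ln_ge0// lerDl sqr_ge0.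
  have lnf : 0 <= ln ((d * k)`!)%:R :> R by rewrite ln_ge0// ler1n fact_gt0.
  by rewrite !addr_ge0 ?mulr_ge0 ?addr_ge0 ?mulr_ge0 ?group_norm_ge0// ltW.
have := ler_wpM2l (ltW G1) detA; have := mulr_ge0 (ltW eta0) breg0.
move: CT; rewrite /C0 -w1; set c := ((_ + _) / ln 2).
move=> CT breg0' detA' H; lra.
Qed.
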